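(* Let $\mathcal H\subset\mathbf{RP}^n$ be a finite subset with $|\mathcal H|=T$ whose representatives span $\mathbf R^{n+1}$, let $\mathbb F$ be a field, and let $\langle w\rangle\in\mathcal H$. Then $$\mathrm{rank}\,H_n(K^{\mathcal H},K^{\mathcal H}_{n-1};\mathbb F)\le\frac{1}{(T-1)!}\sum_{k=0}^{n-2}\ \sum_{U\in\langle\mathcal H;w\notin\rangle^{\times(n-k)}_{\ne0}}\frac{1}{q^U_{n-k-1}\cdots q^U_1}\sum_{d=k+3}^{T-q^U_{n-k-1}}\frac{(T-d)!\,(T-q^U_{n-k}-1)!}{(T-q^U_{n-k-1}-d)!}\,A_{n-k}(U;d)\binom{d-2}{k}\ +\ D_n(\mathcal H;w),$$ where $$A_{n-k}(U;d)=\left[\binom{T-q^U_{n-k-1}-2}{q^U_{n-k}-q^U_{n-k-1}-1}-\binom{T-q^U_{n-k-1}-d}{q^U_{n-k}-q^U_{n-k-1}-1}\right](q^U_{n-k}-q^U_{n-k-1}-1)!.$$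
   Context: $\mathbf{RP}^n$ is the set of $1$-dimensional subspaces of $\mathbf R^{n+1}$; $\langle v\rangle$ is the line spanned by $v\neq 0$. For a finite $\mathcal H\subset\mathbf{RP}^n$ whose representatives span $\mathbf R^{n+1}$, $K^{\mathcal H}$ is the simplicial complex with vertex set $\mathcal H$ in which a subset of $\mathcal H$ is a simplex iff its representatives span a proper subspace of $\mathbf R^{n+1}$; $K^{\mathcal H}_{n-1}$ is its $(n-1)$-skeleton. For $s\ge1$, $\langle\mathcal H;w\notin\rangle^{\times s}_{\ne0}$ is the set of ordered $s$-tuples $U$ of distinct elements of $\mathcal H$ whose representatives are linearly independent and whose span does not contain $w$. For such $U=(\langle u_{s}\rangle,\langle u_{s-1}\rangle,\dots,\langle u_1\rangle)$ (written so that the last $l$ entries are $\langle u_l\rangle,\dots,\langle u_1\rangle$) and $1\le l\le s$, $q^U_l$ is the number of points of $\mathcal H$ contained in $\mathrm{span}(u_l,\dots,u_1)$, the span of the last $l$ entries. $D_n(\mathcal H;w)$ is the number of $n$-element subsets $\{\langle w_{i_1}\rangle,\dots,\langle w_{i_n}\rangle\}\subset\mathcal H\setminus\{\langle w\rangle\}$ such that $w,w_{i_1},\dots,w_{i_n}$ are linearly dependent. *)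

(* Defs.v *)
From HB Require Import structures.
From mathcomp Require Import all_boot all_order all_algebra.
From mathcomp Require Import finmap reals.

Set Implicit Arguments.
Unset Strict Implicit.
Unset Printing Implicit Defensive.

Import Order.TTheory GRing.Theory Num.Theory.
Local Open Scope ring_scope.

Section RelativeHomology.
Variables (F : fieldType) (V : finType).
Implicit Types (K L : {set {set V}}) (s t : {set V}).

Definition simplicial_complex K : Prop :=
  forall s t, s \in K -> t \subset s -> t \in K.

(* A simplex s has dimension #|s| - 1, so this is the (n-1)-skeleton of K
   (which has no vertex when n = 0). *)
Definition skeleton_lt (n : nat) K : {set {set V}} :=
  [set s in K | (#|s| <= n)%N].

Local Notation chain := {ffun {set V} -> F^o}.

(* The simplex s, oriented by the enumeration order of V. *)
Definition simplex s : chain := [ffun t => (t == s)%:R].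

(* The index of the vertex x of s in this order, counting from 0. *)
Definition position s (x : V) : nat :=
  #|[set y in s | (enum_rank y < enum_rank x)%N]|.

(* The complex is not augmented: the boundary of a vertex is 0. *)
Definition simplex_boundary s : chain :=
  if (1 < #|s|)%N then \sum_(x in s) (-1) ^+ position s x *: simplex (s :\ x)
  else 0.

Definition boundary_fun (c : chain) : chain :=
  \sum_(s : {set V}) c s *: simplex_boundary s.

Lemma boundary_fun_linear : linear boundary_fun.
Proof.
move=> a u v; rewrite /boundary_fun scaler_sumr -big_split /=.
by apply: eq_bigr => s _; rewrite !ffunE scalerDl scalerA.
Qed.
HB.instance Definition _ :=
  GRing.isLinear.Build F chain chain *:%R boundary_fun boundary_fun_linear.

Definition boundary : 'End(chain) := linfun boundary_fun.

(* Graded by number of vertices: chains m K is C_(m-1)(K; F). *)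
Definition chains (m : nat) K : {vspace chain} :=
  <<[seq simplex s | s <- enum K & #|s| == m]>>%VS.

(* Z_k(K, L), the chains of C_k(K) whose boundary lies in C_(k-1)(L). *)
Definition rel_cycles (k : nat) K L : {vspace chain} :=
  (chains k.+1 K :&: boundary @^-1: chains k L)%VS.

(* B_k(K, L) = boundary of C_(k+1)(K), plus C_k(L). *)
Definition rel_boundaries (k : nat) K L : {vspace chain} :=
  (boundary @: chains k.+2 K + chains k.+1 L)%VS.

(* The dimension of H_k(K, L; F) = Z_k(K, L) / B_k(K, L); the inclusion of B_k
   in Z_k is rel_boundaries_sub below. *)
Definition rank_rel_homology (k : nat) K L : nat :=
  (\dim (rel_cycles k K L) - \dim (rel_boundaries k K L))%N.

Lemma boundary_simplex s : boundary (simplex s) = simplex_boundary s.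
Proof.
rewrite lfunE /= /boundary_fun (bigD1 s) //= ffunE eqxx scale1r big1 ?addr0 //.
by move=> t /negbTE ts; rewrite ffunE ts scale0r.
Qed.

Lemma position_D1 s x y : x \in s ->
  position s y = (position (s :\ x) y + (enum_rank x < enum_rank y))%N.
Proof.
move=> xs; rewrite /position (cardsD1 x) addnC inE xs /=; congr (_ + _)%N.
by apply: eq_card => z; rewrite !inE andbA.
Qed.

Lemma boundary_boundary c : boundary (boundary c) = 0.
Proof.
have bb s : boundary (simplex_boundary s) = 0.
  rewrite /simplex_boundary; case: ifP => _; last by rewrite linear0.
  rewrite linear_sum /=.
  have [s2|s2] := leqP #|s| 2.
    apply: big1 => x xs; rewrite linearZ /= boundary_simplex /simplex_boundary.
    case: ifP => h; last by rewrite scaler0.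
    by move: s2; rewrite (cardsD1 x) xs ltnNge h.
  pose f x y : chain := (-1) ^+ (position s x + position (s :\ x) y)%N
                 *: simplex (s :\ x :\ y).
  have -> : \sum_(x in s) boundary ((-1) ^+ position s x *: simplex (s :\ x)) =
            \sum_(x in s) \sum_(y in s | y != x) f x y.
    apply: eq_bigr => x xs.
    rewrite linearZ /= boundary_simplex /simplex_boundary.
    have -> : (1 < #|s :\ x|)%N by move: s2; rewrite (cardsD1 x) xs.
    rewrite scaler_sumr; apply: eq_big => [y|y _]; first by rewrite !inE andbC.
    by rewrite scalerA -exprD.
  have fN x y : x \in s -> y \in s -> (enum_rank x < enum_rank y)%N ->
      f y x = - f x y.
    move=> xs ys xy; rewrite /f (position_D1 y xs) (position_D1 x ys) xy.
    rewrite [(enum_rank y < _)%N]ltnNge ltnW //= addn0 addn1 addSn exprS.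
    rewrite mulN1r scaleNr addnC; congr (- (_ *: simplex _)).
    by rewrite !setDDl setUC.
  have -> : \sum_(x in s) \sum_(y in s | y != x) f x y =
      \sum_(x in s) \sum_(y in s | (enum_rank x < enum_rank y)%N) f x y +
      \sum_(x in s) \sum_(y in s | (enum_rank y < enum_rank x)%N) f x y.
    rewrite -big_split /=; apply: eq_bigr => x xs.
    rewrite (bigID (fun y => (enum_rank x < enum_rank y)%N)) /=.
    congr (_ + _); apply: eq_bigl => y; rewrite -andbA; congr (_ && _);
      rewrite -(inj_eq enum_rank_inj) -val_eqE /= neq_ltn;
      by case: ltngtP.
  rewrite [X in _ + X](exchange_big_dep (fun y => y \in s)) /=; last first.
    by move=> x y _ /andP[].
  rewrite -big_split; apply: big1 => x xs /=; rewrite xs -big_split.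
  by apply: big1 => y /andP[ys xy] /=; rewrite (fN x y) // subrr.
rewrite [boundary c]lfunE /= /boundary_fun linear_sum big1 //= => s _.
by rewrite linearZ /= bb scaler0.
Qed.

Lemma mem_chains m K s : s \in K -> #|s| = m -> simplex s \in chains m K.
Proof.
move=> sK sm; apply/memv_span/map_f.
by rewrite mem_filter sm eqxx mem_enum.
Qed.

Lemma boundary_chains m K : simplicial_complex K ->
  (boundary @: chains m.+1 K <= chains m K)%VS.
Proof.
move=> cK; rewrite limg_span; apply/span_subvP => _ /mapP[_ /mapP[s + ->] ->].
rewrite mem_filter mem_enum => /andP[/eqP sm sK].
rewrite boundary_simplex /simplex_boundary; case: ifP => _; last exact: mem0v.
apply: memv_suml => x xs; apply/memvZ/mem_chains.
  by apply: cK sK _; apply: subsetDl.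
by move: sm; rewrite (cardsD1 x) xs => -[].
Qed.

Lemma rel_boundaries_sub k K L :
    simplicial_complex K -> simplicial_complex L -> L \subset K ->
  (rel_boundaries k K L <= rel_cycles k K L)%VS.
Proof.
move=> cK cL LK; rewrite /rel_boundaries /rel_cycles subv_add !subv_cap.
rewrite boundary_chains //=; apply/and3P; split.
- apply/subvP => _ /memv_imgP[c _ ->].
  by rewrite -memv_preim boundary_boundary mem0v.
- apply/sub_span => _ /mapP[s + ->]; rewrite mem_filter mem_enum => /andP[sm sL].
  by apply/map_f; rewrite mem_filter sm mem_enum (subsetP LK).
- apply/subvP => c cL1; rewrite -memv_preim.
  exact/(subvP (boundary_chains k cL))/memv_img.
Qed.

End RelativeHomology.

Definition RP (R : realType) (n : nat) :=
  {L : {vspace 'rV[R]_n.+1} | \dim L == 1%N}.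
HB.instance Definition _ R n := Choice.on (RP R n).

Section Arrangement.
Variables (R : realType) (n : nat).
Local Notation vec := 'rV[R]_n.+1.

(* A representative of the line L; nothing below depends on its choice. *)
Definition rep (L : RP R n) : vec := vpick (val L).

Lemma rep_neq0 L : rep L != 0.
Proof. by rewrite vpick0 -dimv_eq0 (eqP (valP L)). Qed.

Lemma line_rep L : val L = <[rep L]>%VS.
Proof.
apply/esym/eqP; rewrite eqEdim -memvE memv_pick /= (eqP (valP L)).
by rewrite dim_vline rep_neq0.
Qed.

Definition reps (s : seq (RP R n)) : seq vec := [seq rep x | x <- s].

Variable (H : {fset RP R n}).

Definition pts (s : seq H) : seq (RP R n) := [seq val x | x <- s].

Definition KH : {set {set H}} :=
  [set s : {set H} | <<reps (pts (enum s))>>%VS != fullv].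

Lemma KH_complex : simplicial_complex KH.
Proof.
move=> s t; rewrite !inE => sK ts; apply: contraNneq sK => tf.
rewrite eqEsubv subvf -tf /=; apply/sub_span => v.
rewrite /reps /pts -!map_comp => /mapP[x]; rewrite mem_enum => xt ->.
by apply: map_f; rewrite mem_enum (subsetP ts).
Qed.

(* Membership of U in <H; w notin>^{x s}_{<> 0}, s being the size of U. *)
Definition independent_avoiding (w : H) (U : seq H) : bool :=
  [&& uniq U, free (reps (pts U)) & rep (val w) \notin <<reps (pts U)>>%VS].

(* U lists u_s, ..., u_1 in this order, so that its last l entries are
   u_l, ..., u_1. *)
Definition q_count (U : seq H) (l : nat) : nat :=
  #|[set x : H | (val (val x) <= <<reps (pts (drop (size U - l) U))>>)%VS]|.

Definition D_count (w : H) : nat :=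
  #|[set A : {set H} | [&& #|A| == n, w \notin A
       & ~~ free (rep (val w) :: reps (pts (enum A)))]]|.

(* A_m(U; d), with T = #|` H |; the truncated subtractions are exact whenever
   U is independent and 3 <= d <= T - q_(m-1). *)
Definition A_coef (T m : nat) (U : seq H) (d : nat) : rat :=
  ('C(T - q_count U m.-1 - 2, q_count U m - q_count U m.-1 - 1)%:R
   - 'C(T - q_count U m.-1 - d, q_count U m - q_count U m.-1 - 1)%:R)
  * (q_count U m - q_count U m.-1 - 1)`!%:R.

End Arrangement.

(* Main.v *)
(* Order H linearly, and call y active for A when y lies in the span of the
   elements of A that come after y.  As the n-skeleton has no n-simplex, the
   homology is C_n(K) modulo the boundaries of (n+1)-simplices.  If s is an
   n-simplex that is not a face of a simplex containing w, then s spans a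
   hyperplane missing w and some x in s is active for A = s \ x.  Let y be the
   largest active element of A; if y is not x, the boundary of s + y rewrites s
   into cones over w, simplices B + y with y the largest active element of B, and
   simplices earlier in the order.  So the quotient is spanned by the cones w A in K and by
   one simplex for each basis w A with an active element: the rank is at most
   D_n(H; w) plus the number of these broken bases, for every order.

   Average this over the (T - 1)! orders in which w comes first.  In a broken basis
   A, let U = (u_m, ..., u_1) be the shortest final segment whose leading point is
   not the first point of its span, and d the rank of u_m in the order, starting
   at 1; the other k = n - m elements of A are among the d - 2 points strictly
   between w and u_m, whence the factor C(d - 2, k).  In a uniform random order
   the events "u_l comes first in span (u_l, ..., u_1)", for l < m, are
   independent of probability 1 / q_l.  The two binomials in A_m(U; d) count the
   orders in which span (u_(m-1), ..., u_1) comes after u_m, minus those in which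
   the whole of span U does. *)

Require Import Defs.
From mathcomp Require Import all_boot all_order all_algebra all_fingroup.
From mathcomp Require Import finmap reals zify.

Import GRing.Theory Num.Theory.
Local Open Scope ring_scope.

(** * Counting orders *)

Section Orderings.
Set Implicit Arguments.
Unset Strict Implicit.
Local Open Scope nat_scope.
Variable V : finType.
Implicit Types (x y z u w : V) (Q S : {set V}) (sigma : {perm V}).

(** Linear orders on V are encoded by permutations, so that multiplication by a transposition
    exchanges the places of two points. Places count from 0. *)
Definition pos sigma x : nat := enum_rank (sigma x).

Lemma pos_inj sigma : injective (pos sigma).
Proof. by move=> x y /val_inj/enum_rank_inj/perm_inj. Qed.

Lemma pos_tperm sigma x y z : pos (tperm x y * sigma) z = pos sigma (tperm x y z).
Proof. by rewrite /pos permM. Qed.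

Lemma card_pos (P : pred nat) sigma :
  #|[set x | P (pos sigma x)]| = \sum_(i < #|V|) P i.
Proof.
rewrite -sum1_card (eq_bigl (fun x => P (pos sigma x))); last by move=> x; rewrite inE.
rewrite big_mkcond /=.
have f_bij : {on predT, bijective (fun x => enum_rank (sigma x))}.
  apply: onW_bij; exists (fun i => sigma^-1 (enum_val i))%g => [x|i].
    by rewrite enum_rankK permK.
  by rewrite permKV enum_valK.
by rewrite (reindex _ f_bij); apply: eq_bigr => x _; rewrite /pos; case: (P _).
Qed.

Lemma tperm_mem (Q : {set V}) x y z :
  (x \in Q) = (y \in Q) -> (tperm x y z \in Q) = (z \in Q).
Proof. by move=> xyQ; case: tpermP => [->|->|]. Qed.

(* Composing with the transposition of x and y exchanges P _ x and P _ y. *)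
Lemma double_count (Omega : {set {perm V}}) (P : {perm V} -> V -> bool) S x c :
    (forall y sigma, y \in S -> sigma \in Omega -> (tperm x y * sigma)%g \in Omega) ->
    (forall y sigma, y \in S -> P (tperm x y * sigma)%g x = P sigma y) ->
    (forall sigma, sigma \in Omega -> #|[set y in S | P sigma y]| = c) ->
  #|S| * #|[set sigma in Omega | P sigma x]| = c * #|Omega|.
Proof.
move=> stab equiv countP.
have card_y y : y \in S ->
    #|[set sigma in Omega | P sigma y]| = #|[set sigma in Omega | P sigma x]|.
  move=> yS; rewrite -(card_imset _ (mulgI (tperm x y))).
  apply: eq_card => tau; rewrite inE; apply/imsetP/idP.
    case=> sigma; rewrite inE => /andP[sO Ps] ->.
    by rewrite stab // equiv.
  move=> /andP[tO Pt]; exists (tperm x y * tau)%g; last by rewrite mulgA tperm2 mul1g.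
  by rewrite inE stab // -equiv // mulgA tperm2 mul1g.
rewrite -sum_nat_const -(eq_bigr _ card_y).
transitivity (\sum_(sigma in Omega) \sum_(y in S | P sigma y) 1).
  rewrite (exchange_big_dep (mem S)) /=; last by move=> s y _ /andP[].
  apply: eq_bigr => y yS; rewrite -sum1_card; apply: eq_bigl => sigma.
  by rewrite inE yS.
rewrite mulnC -sum_nat_const; apply: eq_bigr => sigma /countP <-.
by rewrite -sum1_card; apply: eq_bigl => y; rewrite inE.
Qed.

Definition orderings_at w u p Q : {set {perm V}} :=
  [set sigma | [&& pos sigma w == 0, pos sigma u == p
                 & [forall x in Q, p < pos sigma x]]].

Lemma orderings_at_tperm w u p Q x y sigma :
    x != w -> x != u -> y != w -> y != u -> (x \in Q) = (y \in Q) ->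
  sigma \in orderings_at w u p Q -> (tperm x y * sigma)%g \in orderings_at w u p Q.
Proof.
move=> xw xu yw yu xyQ; rewrite !inE !pos_tperm !tpermD // => /and3P[-> -> /=].
move=> /forall_inP sQ; apply/forall_inP => z zQ.
by rewrite pos_tperm sQ // tperm_mem.
Qed.

Section Minima.
(** [FF l] will be the set of points in the span of u_l, ..., u_1, and [uu l] will be u_l. *)
Variables (m : nat) (uu : nat -> V) (FF : nat -> {set V}) (w u : V) (Q : {set V}).
Hypothesis uuF : forall l, 0 < l < m -> uu l \in FF l.
Hypothesis uuF' : forall l j, 0 < j < l -> l < m -> uu l \notin FF j.
Hypothesis FF_mono : forall l j, j <= l < m -> FF j \subset FF l.
Hypothesis FFQ : forall l, l < m -> FF l \subset Q.
Hypotheses (wQ : w \notin Q) (uQ : u \notin Q).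

(** The lower bound [i] is there for an induction; the application takes i = 1. *)
Definition minima sigma i :=
  [forall l : 'I_m, (i <= l) ==> [forall x in FF l, pos sigma (uu l) <= pos sigma x]].

Lemma minimaP sigma i :
  reflect (forall l, i <= l < m ->
            forall x, x \in FF l -> pos sigma (uu l) <= pos sigma x)
          (minima sigma i).
Proof.
apply: (iffP forallP) => [min l /andP[il lm] x xF|min l].
  by have /implyP/(_ il)/forall_inP/(_ x xF) := min (Ordinal lm).
by apply/implyP => il; apply/forall_inP => x; apply: min; rewrite il ltn_ord.
Qed.

(* Peels off the largest FF l first: transposing points of FF i moves neither the
   larger FF l nor their points uu l. *)
Lemma card_minima p i : 0 < i <= m ->
  #|[set sigma in orderings_at w u p Q | minima sigma i]|
    * \prod_(i <= l < m) #|FF l| = #|orderings_at w u p Q|.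
Proof.
move=> /andP[i0 im]; move: {-1}(m - i) (erefl (m - i)) => e.
elim: e i i0 im => [|e IHe] i i0 im De.
  have -> : i = m by lia.
  rewrite big_geq // muln1; apply: eq_card => s; rewrite inE.
  rewrite [X in _ && X](_ : _ = true) ?andbT //.
  by apply/minimaP => l; lia.
have {}im : i < m by lia.
have uiF : uu i \in FF i by rewrite uuF ?i0.
rewrite big_ltn // -(IHe i.+1) //; last by lia.
rewrite mulnA; congr (_ * _); rewrite mulnC.
pose P sigma x := [forall y in FF i, pos sigma x <= pos sigma y].
pose Omega := [set sigma in orderings_at w u p Q | minima sigma i.+1].
rewrite -[RHS]mul1n -(@double_count Omega P (FF i) (uu i)).
- congr (_ * _); apply: eq_card => s; rewrite /Omega !inE -!andbA; do 3!congr (_ && _).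
  apply/minimaP/andP => [min|[/minimaP min /forall_inP Pi] l].
    split; last by apply/forall_inP/min; rewrite leqnn.
    by apply/minimaP => l /andP[il lm]; apply: min; rewrite ltnW.
  have [<- _ x|il lm] := eqVneq i l; first exact: Pi.
  by apply: min; lia.
- move=> y s yF; rewrite !inE => /andP[sO /minimaP min].
  have FiQ := subsetP (FFQ im); have yQ := FiQ _ yF; have uiQ := FiQ _ uiF.
  have neqQ z v : z \in Q -> v \notin Q -> z != v.
    by move=> zQ; apply: contraNneq => <-.
  apply/andP; split.
    have := @orderings_at_tperm w u p Q (uu i) y s.
    by rewrite !inE !neqQ // yQ uiQ; apply.
  apply/minimaP => l lm z zF; rewrite !pos_tperm.
  have Fil : FF i \subset FF l by apply: FF_mono; lia.
  have ul : uu l \notin FF i by apply: uuF'; lia.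
  rewrite [tperm _ _ (uu l)]tpermD.
  + apply: min => //; rewrite tperm_mem //.
    by rewrite !(subsetP Fil).
  + by apply: contraNneq ul => <-.
  + by apply: contraNneq ul => <-.
- move=> y s yF; rewrite /P; apply/forall_inP/forall_inP => min z zF.
    have := min (tperm (uu i) y z); rewrite !pos_tperm tpermL tpermK.
    by apply; rewrite tperm_mem // yF uiF.
  rewrite !pos_tperm tpermL; apply: min.
  by rewrite tperm_mem // yF uiF.
(* Every order has exactly one first point in [FF i], so the constant of the double count is 1. *)
- move=> s _; have [x xF xmin] := arg_minnP (pos s) uiF.
  rewrite -(cards1 x); apply: eq_card => y; rewrite !inE.
  apply/andP/eqP => [[yF /forall_inP ymin]|->].
    by apply: (@pos_inj s); apply/eqP; rewrite eqn_leq ymin // xmin.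
  by split => //; apply/forall_inP => z; apply: xmin.
Qed.

End Minima.
Variable N : nat.
Hypothesis cardV : #|V| = N.

Lemma pos_lt sigma x : pos sigma x < N.
Proof. by rewrite -cardV ltn_ord. Qed.

Lemma card_pos_eq sigma p : p < N -> #|[set x | pos sigma x == p]| = 1.
Proof.
rewrite (card_pos (pred1 p)) cardV; elim: (N) => // M IHM pM.
rewrite big_ord_recr /=; have [->|Mp] := eqVneq M p.
  by rewrite big1 // => i _; rewrite ltn_eqF // -ltnS.
by rewrite IHM //; lia.
Qed.

Lemma card_pos_gt sigma p : #|[set x | p < pos sigma x]| = N - p.+1.
Proof.
rewrite (card_pos (fun i => p < i)) cardV; elim: (N) => [|M IHM].
  by rewrite big_ord0.
by rewrite big_ord_recr /= IHM; lia.
Qed.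

Lemma card_pos_between sigma p :
  p <= N -> #|[set x | 0 < pos sigma x < p]| = p.-1.
Proof.
rewrite (card_pos (fun i => 0 < i < p)) cardV.
have -> : forall M, \sum_(i < M) (0 < i < p) = (minn M p).-1.
  by elim=> [|M IHM]; rewrite ?big_ord0 ?big_ord_recr /= ?IHM; lia.
by lia.
Qed.

Definition first_orderings w : {set {perm V}} := [set sigma | pos sigma w == 0].

(** By symmetry each of the N points comes first equally often among the N! orders. *)
Lemma card_first_orderings w : #|first_orderings w| = (N.-1)`!.
Proof.
have N0 : 0 < N by rewrite -cardV; apply/card_gt0P; exists w.
have cP : #|[set: {perm V}]| = N`!.
  rewrite -cardV -[#|V|]cardsT -card_perm; apply: eq_card => s.
  by rewrite !inE; apply/esym/subsetP => x _; rewrite !inE.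
have dc : N * #|first_orderings w| = N`!.
  rewrite -cP -[RHS]mul1n -[X in X * _]cardV -[#|V|]cardsT.
  rewrite -(@double_count setT (fun sigma x => pos sigma x == 0) setT w).
  - by congr (_ * _); apply: eq_card => s; rewrite !inE.
  - by move=> y s _ _; rewrite inE.
  - by move=> y s _; rewrite pos_tperm tpermL.
  - move=> s _; rewrite -(card_pos_eq s N0); apply: eq_card => x.
    by rewrite !inE.
move: dc; case: (N) N0 => // M _; rewrite factS => /eqP.
by rewrite eqn_pmul2l // => /eqP.
Qed.

(** Once w is first, the other N - 1 points are equally often at place p. *)
Lemma card_orderings_at0 w u p :
  u != w -> 0 < p < N -> #|orderings_at w u p set0| = (N - 2)`!.
Proof.
move=> uw /andP[p0 pV].
have dc : #|[set~ w]| * #|orderings_at w u p set0| = 1 * #|first_orderings w|.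
  pose P sigma x := pos sigma x == p.
  rewrite -(@double_count (first_orderings w) P [set~ w] u).
  - congr (_ * _); apply: eq_card => s; rewrite !inE; congr (_ && _).
    rewrite [X in _ && X](_ : _ = true) ?andbT //.
    by apply/forall_inP => x; rewrite inE.
  - move=> y s; rewrite !inE => yw; rewrite pos_tperm tpermD // eq_sym //.
  - by move=> y s _; rewrite /P pos_tperm tpermL.
  - move=> s; rewrite inE => /eqP sw; rewrite -(card_pos_eq s pV).
    apply: eq_card => x; rewrite !inE.
    by case: (eqVneq x w) => // ->; rewrite sw ltn_eqF.
move: dc; rewrite mul1n card_first_orderings cardsC1 cardV.
case: (N) pV => [|[|M]] // pV.
by rewrite factS subSS subn1 /= => /eqP; rewrite eqn_pmul2l // => /eqP.
Qed.

(** The falling factorial puts Q on the N - p - 1 places after u, and the factorial arranges the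
    remaining points. The proof adds the points of Q one at a time. *)
Lemma card_orderings_at w u p Q :
    u != w -> 0 < p < N -> w \notin Q -> u \notin Q ->
  #|orderings_at w u p Q| = (N - p.+1) ^_ #|Q| * (N - 2 - #|Q|)`!.
Proof.
move=> uw pV; move: {-1}#|Q| (erefl #|Q|) => m.
elim: m Q => [|m IHm] Q.
  move/eqP; rewrite cards_eq0 => /eqP -> _ _.
  by rewrite card_orderings_at0 // mul1n subn0.
move=> Qm wQ uQ; have [x xQ] : exists x, x \in Q by apply/card_gt0P; rewrite Qm.
pose Q' := Q :\ x; have Q'm : #|Q'| = m by move: Qm; rewrite (cardsD1 x) xQ => -[].
have wQ' : w \notin Q' by rewrite !inE (negPf wQ) andbF.
have uQ' : u \notin Q' by rewrite !inE (negPf uQ) andbF.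
(* The points other than w, u and those of Q' are interchangeable, and N - p - 1 - m of them come
   after u. *)
pose S := ~: (w |: (u |: Q')).
have cS : #|S| = N - 2 - m.
  rewrite [LHS]cardsCs cardV setCK !cardsU1 in_setU1 negb_or wQ' uQ' eq_sym uw Q'm; lia.
have S_mem y : y \in S = [&& y != w, y != u & y \notin Q'].
  by rewrite !inE !negb_or.
have xS : x \in S.
  rewrite S_mem !inE eqxx /= andbT; apply/andP.
  by split; apply: contraTneq xQ => ->.
have dc : #|S| * #|orderings_at w u p Q| =
    (N - p.+1 - m) * #|orderings_at w u p Q'|.
  rewrite -(@double_count (orderings_at w u p Q') (fun sigma x => p < pos sigma x) S x).
  - congr (_ * _); apply: eq_card => s; rewrite !inE -!andbA; do 2!congr (_ && _).
    apply/forall_inP/andP => [sQ|[/forall_inP sQ' sx] y yQ].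
      by split; [apply/forall_inP => y; rewrite !inE => /andP[_ /sQ]|apply: sQ].
    by have [->//|yx] := eqVneq y x; rewrite sQ' // !inE yx.
  - move=> y s; move: xS; rewrite !S_mem => /and3P[xw xu xQ'] /and3P[yw yu yQ'].
    by apply: orderings_at_tperm => //; rewrite (negPf xQ') (negPf yQ').
  - by move=> y s _; rewrite pos_tperm tpermL.
  - move=> s; rewrite !inE => /and3P[/eqP sw /eqP su /forall_inP sQ'].
    rewrite -(card_pos_gt s) -Q'm -cardsDS; last first.
      by apply/subsetP => y /sQ'; rewrite inE.
    apply: eq_card => y; rewrite inE S_mem !inE -andbA.
    case: (eqVneq y w) => [->|yw] /=; first by rewrite sw ltn0 andbF.
    by case: (eqVneq y u) => [->|yu] //=; rewrite su ltnn andbF.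
move: dc; rewrite (IHm _ Q'm) // cS ffactnSr.
have : 0 < #|S| by apply/card_gt0P; exists x.
rewrite cS; case D: (_ - 2 - m) => [//|r] _; rewrite factS.
have -> : N - 2 - m.+1 = r by lia.
move=> dc; apply/eqP; rewrite -(eqn_pmul2l (ltn0Sn r)) dc; apply/eqP; lia.
Qed.

End Orderings.

(** * Activity and the homology bound *)

Section Flats.
Set Implicit Arguments.
Unset Strict Implicit.
Variables (K : fieldType) (vT : vectType K) (V : finType) (r : V -> vT).
Implicit Types (x y : V) (s t : {set V}).

Definition flat_span s : {vspace vT} := (\sum_(x in s) <[r x]>)%VS.

Lemma mem_flat s x : x \in s -> r x \in flat_span s.
Proof. by move=> xs; rewrite memvE; apply: (sumv_sup x). Qed.

Lemma flat_subP s (U : {vspace vT}) :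
  reflect (forall x, x \in s -> r x \in U) (flat_span s <= U)%VS.
Proof.
by apply: (iffP subv_sumP) => sU x xs; have := sU x xs; rewrite -memvE.
Qed.

Lemma flatS s t : s \subset t -> (flat_span s <= flat_span t)%VS.
Proof. by move/subsetP=> st; apply/flat_subP => x /st; apply: mem_flat. Qed.

Lemma flatU1 x s : flat_span (x |: s) = (<[r x]> + flat_span s)%VS.
Proof.
apply/eqP; rewrite eqEsubv subv_add -memvE mem_flat ?setU11 // flatS ?subsetUr //.
rewrite !andbT; apply/flat_subP => y; rewrite !inE => /predU1P[->|ys].
  by rewrite memvE addvSl.
by apply: (subvP (addvSr _ _)); apply: mem_flat.
Qed.

Lemma flatU1_mem x s : r x \in flat_span s -> flat_span (x |: s) = flat_span s.
Proof. by move=> xs; rewrite flatU1; apply/addv_idPr; rewrite -memvE. Qed.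

Lemma dim_flat s : (\dim (flat_span s) <= #|s|)%N.
Proof.
rewrite -sum1_card; apply: leq_trans (dimv_leq_sum _ _ _) _.
by apply: leq_sum => x _; rewrite dim_vline leq_b1.
Qed.

Lemma dim_flatU1 x s : (\dim (flat_span (x |: s)) <= (\dim (flat_span s)).+1)%N.
Proof.
rewrite flatU1 -add1n; apply: leq_trans (dimv_add_leqif _ _) _.
by rewrite leq_add2r dim_vline leq_b1.
Qed.

Lemma dim_flatU1_notin x s :
  r x \notin flat_span s -> \dim (flat_span (x |: s)) = (\dim (flat_span s)).+1.
Proof.
move=> xs; apply/eqP; rewrite eqn_leq dim_flatU1 ltn_neqAle dimvS ?flatS ?subsetUr //.
rewrite andbT; apply: contra xs => /eqP dE.
have /eqP-> : flat_span s == flat_span (x |: s).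
  by rewrite eqEdim flatS ?subsetUr // dE leqnn.
by rewrite mem_flat ?setU11.
Qed.

Lemma flatD1_notin s x :
  \dim (flat_span s) = #|s| -> x \in s -> r x \notin flat_span (s :\ x).
Proof.
move=> ds xs; apply/negP => /flatU1_mem; rewrite setD1K // => sE.
by have := dim_flat (s :\ x); rewrite -sE ds (cardsD1 x s) xs ltnn.
Qed.

Lemma span_map_flat (l : seq V) : (<<map r l>> = flat_span [set x in l])%VS.
Proof.
apply/eqP; rewrite eqEsubv; apply/andP; split.
  by apply/span_subvP => _ /mapP[x xl ->]; apply: mem_flat; rewrite inE.
by apply/flat_subP => x; rewrite inE => xl; apply/memv_span/map_f.
Qed.

Lemma free_map_flat (l : seq V) :
  uniq l -> free (map r l) = (\dim (flat_span [set x in l]) == #|[set x in l]|).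
Proof.
by move=> ul; rewrite /free span_map_flat size_map cardsE (card_uniqP ul).
Qed.

(** * Activity with respect to a linear order *)

Variable pos : V -> nat.
Hypothesis pos_inj : injective pos.

(** For independent s and y outside s this is external activity in the matroid sense: y is the first
    element of the circuit contained in [y |: s]. *)
Definition active s y : bool := r y \in flat_span [set a in s | (pos y < pos a)%N].

Lemma activeS s t y : s \subset t -> active s y -> active t y.
Proof.
move=> /subsetP st; apply/subvP/flatS/subsetP => a.
by rewrite !inE => /andP[/st-> ->].
Qed.

(** The rest of s comes after its first point x, so inactivity of x puts it outside the span of the
    rest; induction does the same for the rest. *)
Lemma dim_flat_inactive s :
  (forall x, x \in s -> ~~ active s x) -> \dim (flat_span s) = #|s|.
Proof.
move: {-1}#|s| (erefl #|s|) => m; elim: m s => [|m IHm] s.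
  by move/eqP; rewrite cards_eq0 => /eqP-> _; rewrite /flat_span big_set0 dimv0.
move=> sm inact; have [x0 x0s] : exists x, x \in s by apply/card_gt0P; rewrite sm.
have [x xs xmin] := arg_minnP pos x0s; rewrite -/(x \in s) in xs.
have D1 : [set a in s | (pos x < pos a)%N] = s :\ x.
  apply/setP => a; rewrite !inE andbC; case sa: (a \in s); last by rewrite !andbF.
  by rewrite !andbT ltn_neqAle xmin // andbT (inj_eq pos_inj) eq_sym.
have := inact x xs; rewrite /active D1 => /dim_flatU1_notin; rewrite setD1K // => ->.
rewrite IHm //; first by move: sm; rewrite (cardsD1 x s) xs => -[].
move=> y /setD1P[_ ys]; apply: contra (inact y ys).
by apply: activeS; apply: subsetDl.
Qed.

Lemma active_notin s y : \dim (flat_span s) = #|s| -> active s y -> y \notin s.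
Proof.
move=> ds ay; apply/negP => /(flatD1_notin ds)/negP; apply.
apply: (subvP _ _ ay); apply/flatS/subsetP => a; rewrite !inE => /andP[-> ya].
by rewrite andbT; apply: contraTneq ya => ->; rewrite ltnn.
Qed.

Lemma active_flat s y : active s y -> r y \in flat_span s.
Proof. by apply/subvP/flatS/subsetP => a; rewrite inE => /andP[]. Qed.

Definition max_active s y : bool :=
  active s y && [forall z, active s z ==> (pos z <= pos y)%N].

Lemma max_active_exists s y : active s y -> exists z, max_active s z.
Proof.
move=> ay; have [z az zmax] := arg_maxnP pos ay.
exists z; rewrite /max_active az; apply/forall_inP; exact: zmax.
Qed.

(** The default [s] does not occur for a broken basis, which has an active element and hence a
    largest one. *)
Definition adjoin_active s : {set V} :=
  if [pick y | max_active s y] is Some y then y |: s else s.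

Lemma adjoin_activeE s y : max_active s y -> adjoin_active s = y |: s.
Proof.
rewrite /adjoin_active => my; case: pickP => [z mz|/(_ y)]; last by rewrite my.
move: my mz => /andP[ay /forall_inP ymax] /andP[az /forall_inP zmax].
by congr (_ |: _); apply: pos_inj; apply/eqP; rewrite eqn_leq ymax ?zmax.
Qed.

End Flats.

(** * Generators of the relative homology *)

Section HomologyBound.
Set Implicit Arguments.
Unset Strict Implicit.
Variables (R : realType) (n : nat) (H : {fset RP R n}) (F : fieldType).
Variables (pos : H -> nat) (pos_inj : injective pos) (w : H).
Implicit Types (s t A : {set H}).
Local Notation r := (fun x : H => rep (val x)).
Local Notation flat := (flat_span r).
Local Notation K := (KH H).

Lemma reps_pts (l : seq H) : reps (pts l) = map r l.
Proof. by rewrite /reps /pts -map_comp. Qed.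

Lemma KH_flat s : (s \in K) = (flat s != fullv).
Proof.
rewrite inE reps_pts span_map_flat; congr (flat _ != _).
by apply/setP => x; rewrite inE mem_enum.
Qed.

Lemma dimv_RP : \dim {:'rV[R]_n.+1} = n.+1.
Proof. by rewrite dimvf /dim /= mul1n. Qed.

Lemma KH_dim s : (s \in K) = (\dim (flat s) <= n)%N.
Proof.
rewrite KH_flat; apply/idP/idP => [|dn].
  apply: contraR; rewrite -ltnNge => ds.
  by rewrite eqEdim subvf dimv_RP.
by apply: contraTneq dn => ->; rewrite dimv_RP ltnn.
Qed.

Definition degenerate_cones : {set {set H}} :=
  [set A : {set H} | [&& #|A| == n, w \notin A & w |: A \in K]].

(** Since A has n elements, [w |: A \notin K] says that w and A form a basis of the whole space; in
    particular A misses w. *)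
Definition broken_bases : {set {set H}} :=
  [set A : {set H} | [&& #|A| == n, w |: A \notin K & [exists y, active r pos A y]]].

Definition generators : seq {set H} :=
  [seq w |: A | A <- enum degenerate_cones] ++
  [seq adjoin_active r pos A | A <- enum broken_bases].

Local Notation simplex := (@simplex F H).
Local Notation boundary := (@boundary F H).

(** The aim is that this space contains all n-chains of K, so that the generators span them modulo
    boundaries. *)
Definition reducible : {vspace {ffun {set H} -> F^o}} :=
  (boundary @: chains F n.+2 K + <<map simplex generators>>)%VS.

Lemma reducible_generator s : s \in generators -> simplex s \in reducible.
Proof.
by move=> sG; apply/(subvP (addvSr _ _))/memv_span/map_f.
Qed.

(** Every facet of t occurs in its boundary with coefficient 1 or -1, so one facet can be solved for
    in terms of the others. *)
Lemma reducible_facet t y : t \in K -> #|t| = n.+2 -> y \in t ->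
    (forall x, x \in t -> x != y -> simplex (t :\ x) \in reducible) ->
  simplex (t :\ y) \in reducible.
Proof.
move=> tK tn yt red.
have : boundary (simplex t) \in reducible.
  by apply/(subvP (addvSl _ _))/memv_img/mem_chains.
rewrite boundary_simplex /simplex_boundary tn (bigD1 y) //= rpredDr; last first.
  by apply: rpred_sum => x /andP[xt xy]; apply/rpredZ/red.
move/(rpredZ ((-1) ^+ position t y)).
by rewrite scalerA -expr2 sqrr_sign scale1r.
Qed.

Lemma cone_reducible s :
  #|s| = n.+1 -> w \in s -> s \in K -> simplex s \in reducible.
Proof.
move=> sn ws sK; apply: reducible_generator; rewrite mem_cat; apply/orP; left.
rewrite -(setD1K ws); apply: map_f; rewrite mem_enum inE setD1K // sK setD11.
by move: sn; rewrite (cardsD1 w) ws add1n => -[->]; rewrite eqxx.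
Qed.

(** The facets of [w |: s] other than s all contain w. *)
Lemma coned_reducible s :
  #|s| = n.+1 -> w |: s \in K -> simplex s \in reducible.
Proof.
move=> sn sK; have [ws|ws] := boolP (w \in s).
  by apply: cone_reducible => //; apply: KH_complex sK (subsetUr _ _).
rewrite -(setU1K ws); apply: reducible_facet; rewrite ?setU11 //.
  by rewrite cardsU1 ws sn.
move=> x xs xw; apply: cone_reducible.
- by move: sn; have := cardsD1 x (w |: s); rewrite xs cardsU1 ws; lia.
- by rewrite !inE eqxx eq_sym xw.
- exact: KH_complex sK (subsetDl _ _).
Qed.

(* Induction on the sum of the positions of s.  With y the largest active element of
   s :\ x, a facet of y |: s other than s has a smaller sum if it omits an element
   after y that y depends on, and otherwise y is still the largest active element
   of s minus the omitted element. *)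
Lemma simplex_reducible s : #|s| = n.+1 -> s \in K -> simplex s \in reducible.
Proof.
have [m] := ubnP (\sum_(x in s) pos x)%N; elim: m s => // m IHm s sm sn sK.
have [wsK|wsK] := boolP (w |: s \in K); first exact: coned_reducible.
have ds : \dim (flat s) = n.
  move: (sK) (dim_flatU1 r w s) wsK; rewrite !KH_dim; lia.
have ws : w \notin s by apply: contra wsK => ws; rewrite (setUidPr _) // sub1set.
(* n + 1 points in dimension n are dependent, so some point of s depends on later ones. *)
have [x xs axs] : exists2 x, x \in s & active r pos s x.
  apply/exists_inP; move: ds; apply: contra_eqT; rewrite negb_exists_in.
  move/forall_inP => /(dim_flat_inactive pos_inj) ->; rewrite sn.
  by rewrite neq_ltn ltnSn orbT.
pose A := s :\ x.
have An : #|A| = n by move: sn; rewrite (cardsD1 x s) xs => -[].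
have axA : active r pos A x.
  apply: (subvP _ _ axs); apply/flatS/subsetP => a; rewrite !inE => /andP[-> xa].
  by rewrite xa !andbT; apply: contraTneq xa => ->; rewrite ltnn.
have sE : s = x |: A by rewrite setD1K.
have fA : flat A = flat s by rewrite sE (flatU1_mem (active_flat axA)).
have bA : A \in broken_bases.
  rewrite inE An eqxx KH_flat flatU1 fA -flatU1 -KH_flat wsK.
  by apply/existsP; exists x.
have [y my] := max_active_exists axA.
have [ay /forall_inP ymax] := andP my.
have [ys|ys] := boolP (y \in s).
  (* A is independent, so its active y is outside A; hence y = x, and s is the generator attached to
     A. *)
  have yA : y \notin A by apply: active_notin ay; rewrite fA ds.
  have yx : y = x by apply/eqP; apply: contraNT yA => yx; rewrite !inE yx.
  apply: reducible_generator; rewrite mem_cat; apply/orP; right.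
  by rewrite {1}sE -yx -(adjoin_activeE pos_inj my) map_f // mem_enum.
have xy : (pos x < pos y)%N.
  rewrite ltn_neqAle ymax // andbT (inj_eq pos_inj).
  by apply: contraNneq ys => <-.
have asy : active r pos s y by apply: activeS ay; apply: subsetDl.
(* As y lies in the span of s, [y |: s] is still in K, and its other facets remain to be treated. *)
rewrite -(setU1K ys); apply: reducible_facet; rewrite ?setU11 //.
- by rewrite KH_flat (flatU1_mem (active_flat asy)) -KH_flat.
- by rewrite cardsU1 ys sn.
move=> z; rewrite !inE => /orP[/eqP->|zs zy]; first by rewrite eqxx.
pose B := s :\ z.
have Bn : #|B| = n by move: sn; rewrite (cardsD1 z s) zs => -[].
have tE : (y |: s) :\ z = y |: B.
  apply/setP => a; rewrite !inE; case: (eqVneq a y) => // ->.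
  by rewrite eq_sym zy.
have yB : y \notin B by rewrite !inE (negPf ys) andbF.
rewrite tE; have [aB|aB] := boolP (active r pos B y).
  have [wBK|wBK] := boolP (w |: B \in K).
    apply: coned_reducible; first by rewrite cardsU1 yB Bn.
    rewrite KH_flat flatU1 (flatU1_mem (active_flat aB)) -flatU1 -KH_flat //.
  (* A point v active for B and after y would be active for A too: x precedes y, so it is not among
     the points after v. *)
  have mB : max_active r pos B y.
    rewrite /max_active aB; apply/forall_inP => v aBv; rewrite leqNgt.
    apply/negP => yv; have := ymax v; rewrite leqNgt yv => /(_ _)/notF; apply.
    apply: (subvP _ _ aBv); apply/flatS/subsetP => a; rewrite !inE.
    move=> /andP[/andP[_ ->] va]; rewrite va !andbT.
    by apply: contraTneq (ltn_trans yv va) => ->; rewrite -leqNgt ltnW.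
  apply: reducible_generator; rewrite mem_cat; apply/orP; right.
  rewrite -(adjoin_activeE pos_inj mB) map_f // mem_enum inE Bn eqxx wBK /=.
  by apply/existsP; exists y.
(* Omitting z affects the activity of y only if z comes after y; trading such a z for y lowers the
   sum of positions. *)
have yz : (pos y < pos z)%N.
  rewrite ltnNge; apply: contra aB => zy'.
  apply: (subvP _ _ ay); apply/flatS/subsetP => a; rewrite !inE.
  move=> /andP[/andP[_ ->] ya]; rewrite ya !andbT.
  by apply: contraTneq ya => ->; rewrite -leqNgt.
apply: IHm.
- rewrite big_setU1 //=; move: sm; rewrite ltnS; apply: leq_trans.
  by rewrite (big_setD1 z zs) -/B /= ltn_add2r.
- by rewrite cardsU1 yB Bn.
- rewrite -tE; apply: (@KH_complex _ _ _ (y |: s)); last exact: subsetDl.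
  by rewrite KH_flat (flatU1_mem (active_flat asy)) -KH_flat.
Qed.

(** Relative n-cycles are n-chains, hence in [reducible]. Its boundary part lies in the relative
    boundaries, and the generators add at most their number to the dimension. *)
Lemma rank_le_card :
  (rank_rel_homology F n K (skeleton_lt n K) <=
     #|degenerate_cones| + #|broken_bases|)%N.
Proof.
rewrite /rank_rel_homology leq_subLR.
apply: (@leq_trans (\dim (reducible))).
  apply: dimvS; apply: subv_trans (capvSl _ _) _; apply/span_subvP => _ /mapP[s + ->].
  by rewrite mem_filter mem_enum => /andP[/eqP sn sK]; apply: simplex_reducible.
apply: leq_trans (dimv_add_leqif _ _) _; apply: leq_add.
  by apply: dimvS; apply: addvSl.
by apply: leq_trans (dim_span _) _; rewrite size_map size_cat !size_map -!cardE.
Qed.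
End HomologyBound.

(** * Covering the broken bases *)

Section BigUnions.
Set Implicit Arguments.
Unset Strict Implicit.
Variables (T : finType) (I : eqType).
Implicit Types (l : seq I) (P : pred I) (E : I -> {set T}).

Lemma card_bigcup_le l P E :
  (#|\bigcup_(i <- l | P i) E i| <= \sum_(i <- l | P i) #|E i|)%N.
Proof.
elim/big_rec2: _ => [|i k S _ Sk]; first by rewrite cards0.
by rewrite (leq_trans (leq_card_setU _ _)) // leq_add2l.
Qed.

Lemma mem_bigcup_seq l P E i x :
  i \in l -> P i -> x \in E i -> x \in \bigcup_(j <- l | P j) E j.
Proof. by move=> il Pi xE; rewrite (big_rem i) //= Pi inE xE. Qed.

End BigUnions.

Ltac clear_lia :=
  repeat match goal with
  | H : ?P |- _ => lazymatch P with
    | is_true (leq _ _) => fail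
    | is_true (andb (leq _ _) (leq _ _)) => fail
    | @eq nat _ _ => fail
    | nat => fail
    | _ => clear H
    end
  end; lia.

(** * Final segments of a broken basis and their flats *)

Section Averaging.
Set Implicit Arguments.
Unset Strict Implicit.
Local Open Scope nat_scope.
Variables (R : realType) (n : nat) (H : {fset RP R n}) (w : H).
Implicit Types (x : H) (A : {set H}) (U : seq H) (sigma : {perm H}).
Local Notation r := (fun x : H => rep (val x)).
Local Notation flat := (flat_span r).
Local Notation K := (KH H).

Definition tail_flat U l : {set H} :=
  [set x | r x \in flat [set a in drop (size U - l) U]].

Lemma q_countE U l : q_count U l = #|tail_flat U l|.
Proof.
apply: eq_card => x.
by rewrite !inE line_rep -memvE reps_pts span_map_flat.
Qed.

Lemma tail_flatS U l j : j <= l -> tail_flat U j \subset tail_flat U l.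
Proof.
move=> jl; apply/subsetP => x; rewrite !inE; apply/subvP/flatS/subsetP => a.
(* The term [l - size U] covers the l beyond the length of U, where nothing is dropped. *)
rewrite !inE; have -> : size U - j = (l - j - (l - size U)) + (size U - l) by lia.
by rewrite -drop_drop; apply: mem_drop.
Qed.

(* The point u_l of U = (u_s, ..., u_1); it is w for l = 0. *)
Definition tail_point U l : H := nth w U (size U - l).

Lemma mem_tail_flat U l :
  0 < l <= size U -> tail_point U l \in tail_flat U l.
Proof.
move=> lU; rewrite inE; apply: (@mem_flat _ _ _ r); rewrite inE /tail_point.
by rewrite (drop_nth w) ?mem_head //; lia.
Qed.

(** The last l entries are independent, and the last j are among those that remain without u_l. *)
Lemma tail_point_notin U l j : independent_avoiding w U -> j < l <= size U ->
  tail_point U l \notin tail_flat U j.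
Proof.
move=> /and3P[uU fU _] jl.
have uD : uniq (drop (size U - l) U) by apply: drop_uniq.
have dD : \dim (flat [set a in drop (size U - l) U]) = #|[set a in drop (size U - l) U]|.
  apply/eqP; rewrite -(free_map_flat r) //.
  apply: (@catr_free _ _ (map r (take (size U - l) U))).
  by rewrite -map_cat cat_take_drop -reps_pts.
have tD : tail_point U l \in drop (size U - l) U.
  by rewrite /tail_point (drop_nth w) ?mem_head //; lia.
rewrite inE; apply: contra (flatD1_notin dD (x := tail_point U l) _); last by rewrite inE.
apply/subvP/flatS/subsetP => a; rewrite !inE => aj.
have jE : size U - j = (l - j).-1 + (size U - l).+1 by lia.
have aD : a \in drop (size U - l).+1 U.
  by move: aj; rewrite jE -drop_drop; apply: mem_drop.
move: uD; rewrite /tail_point (drop_nth w) /=; last by lia.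
rewrite in_cons aD orbT andbT => /andP[nD _].
by apply: contraNneq nD => <-.
Qed.

Lemma w_notin_tail_flat U l : independent_avoiding w U -> w \notin tail_flat U l.
Proof.
move=> /and3P[_ _]; rewrite reps_pts span_map_flat inE; apply: contra.
by apply/subvP/flatS/subsetP => a; rewrite !inE; apply: mem_drop.
Qed.

(* pos counts from 0 and d from 1, hence d.-1. *)
Definition chain_orderings_at U d (Q : {set H}) : {set {perm H}} :=
  [set sigma in orderings_at w (tail_point U (size U)) d.-1 Q
  | minima (size U) (tail_point U) (tail_flat U) sigma 1].

(** With m the size of U: each u_l with l < m is first in its own span and u_m precedes the span of
    u_(m-1), ..., u_1, but u_m is not first in the span of U. *)
Definition chain_orderings U d : {set {perm H}} :=
  chain_orderings_at U d (tail_flat U (size U).-1) :\: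
  chain_orderings_at U d (tail_flat U (size U) :\ tail_point U (size U)).

Variable T : nat.
Hypothesis cardH : #|` H| = T.

Let cardT : #|{: H}| = T.
Proof. by rewrite -cardfE. Qed.

(** Multiplying by the q_l with l < m removes the conditions that u_l be first in its span; the
    orders left are counted by the places of u_m and Q. *)
Lemma card_chain_orderings_at U d (Q : {set H}) :
    independent_avoiding w U -> 0 < size U -> 1 < d <= T ->
    tail_flat U (size U).-1 \subset Q -> w \notin Q -> tail_point U (size U) \notin Q ->
  #|chain_orderings_at U d Q| * \prod_(1 <= l < size U) q_count U l =
    (T - d) ^_ #|Q| * (T - 2 - #|Q|)`!.
Proof.
move=> iU U0 dT FQ wQ uQ.
under eq_bigr do rewrite q_countE.
rewrite card_minima //.
- rewrite (card_orderings_at cardT) //; first by rewrite prednK //; lia.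
  + apply: contraNneq (w_notin_tail_flat (size U) iU) => <-.
    by rewrite mem_tail_flat // U0 leqnn.
  + lia.
- by move=> l lU; rewrite mem_tail_flat //; lia.
- by move=> l j jl lU; rewrite tail_point_notin //; lia.
- by move=> l j jl; rewrite tail_flatS //; lia.
- by move=> l lU; apply: subset_trans FQ; rewrite tail_flatS //; lia.
Qed.

(** These are the candidates for a broken basis with shortest failing final segment U and u_m at
    rank d. They need not all be broken bases, as only an upper bound is sought. *)
Definition broken_cover sigma (k : nat) U d : {set {set H}} :=
  if sigma \in chain_orderings U d then
    [set B :|: [set x in U] | B in
      [set B : {set H} | B \subset [set x | 0 < pos sigma x < d.-1] & #|B| == k]]
  else set0.

Lemma card_broken_cover sigma k U d : 0 < d <= T ->
  #|broken_cover sigma k U d| <= (sigma \in chain_orderings U d) * 'C(d - 2, k).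
Proof.
move=> dT; rewrite /broken_cover; case: ifP => _; last by rewrite cards0.
rewrite mul1n; apply: leq_trans (leq_imset_card _ _) _.
by rewrite cards_draws (card_pos_between cardT) ?subn2 //; lia.
Qed.

Lemma rep_in_line x y : r x \in <[r y]>%VS -> x = y.
Proof.
move=> xy; apply/val_inj/val_inj/eqP; rewrite eqEdim !line_rep -memvE xy.
by rewrite !dim_vline !rep_neq0.
Qed.

Lemma broken_bases_cover sigma : pos sigma w = 0 ->
  broken_bases (pos sigma) w \subset
    \bigcup_(0 <= k < n - 1)
      \bigcup_(U : (n - k).-tuple H | independent_avoiding w U)
        \bigcup_(k + 3 <= d < (T - q_count U (n - k - 1)).+1) broken_cover sigma k U d.
Proof.
move=> sw; apply/subsetP => A; rewrite inE => /and3P[/eqP An wAK /existsP[y ay]].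
have dA : \dim (flat A) = n.
  have := dim_flat r A; have := dim_flatU1 r w A; move: wAK; rewrite KH_dim An; clear_lia.
have wA : r w \notin flat A.
  apply: contra wAK => wA; rewrite KH_dim (flatU1_mem wA) dA //.
(* A is listed in increasing order, so that its final segments consist of its latest points. *)
pose S := sort (relpre (pos sigma) leq) (enum A).
have SA : [set x in S] = A by apply/setP => x; rewrite inE mem_sort mem_enum.
have memS x : (x \in S) = (x \in A) by rewrite -SA inE.
have Sn : size S = n by rewrite size_sort -cardE.
have uS : uniq S by rewrite sort_uniq enum_uniq.
have iS : independent_avoiding w S.
  rewrite /independent_avoiding uS reps_pts span_map_flat SA wA andbT /=.
  by rewrite free_map_flat // SA dA An.
have sS i j : i < j < n -> pos sigma (nth w S i) < pos sigma (nth w S j).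
  move=> /andP[ij jn].
  rewrite ltn_neqAle (inj_eq (@pos_inj _ _)) nth_uniq ?Sn //; last clear_lia.
  rewrite neq_ltn ij /=.
  have tr : transitive (relpre (pos sigma) leq) by move=> a b c; apply: leq_trans.
  apply: (sorted_ltn_nth tr w) => //; rewrite ?inE ?Sn //; last clear_lia.
  by apply: sort_sorted => a b; apply: leq_total.
pose fail l := (0 < l <= n) &&
  [exists x in tail_flat S l, pos sigma x < pos sigma (tail_point S l)].
have [l0 fl0] : exists l, fail l.
  (* The points of A after the active y form a final segment, whose span contains the earlier point
     y. It is not empty, as y has a nonzero representative. *)
  pose i := find (fun a => pos sigma y < pos sigma a) S.
  have iN : i < n.
    rewrite -Sn -has_find; apply: contraLR ay => /hasPn nS.
    rewrite /active (_ : [set _ in _ | _] = set0).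
      by rewrite /flat_span big_set0 memv0 rep_neq0.
    by apply/setP => a; rewrite !inE; apply/negP => /andP[]; rewrite -memS => /nS/negP.
  exists (n - i); apply/andP; split; first by clear_lia.
  apply/exists_inP; exists y; last first.
    rewrite /tail_point Sn (_ : n - (n - i) = i); last clear_lia.
    have hS : has (fun a => pos sigma y < pos sigma a) S by rewrite has_find Sn.
    exact: (nth_find w hS).
  rewrite inE Sn (_ : n - (n - i) = i); last clear_lia.
  apply: (subvP _ _ ay); apply/flatS/subsetP => a; rewrite !inE -memS => /andP[aS ya].
  move: aS; rewrite -{1}(cat_take_drop i S) mem_cat => /orP[|//].
  move=> /(nthP w)[j]; rewrite size_take Sn iN => ji.
  by rewrite nth_take // => aE; have := before_find w ji; rewrite aE ya.
have [m fm mmin] := ex_minnP (ex_intro _ l0 fl0).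
have [mn /exists_inP[z zm zlt]] := andP fm.
(* The span of a single entry contains no other point of H, so a segment of length 1 cannot fail. *)
have m1 : 1 < m.
  have /andP[m0 mn'] := mn; rewrite ltn_neqAle m0 andbT.
  apply: contraTneq zlt => m1; move: zm; rewrite -m1 inE /tail_point Sn.
  have nn : n - 1 < size S by rewrite Sn; clear_lia.
  rewrite (drop_nth w) // drop_oversize; last by rewrite Sn; clear_lia.
  rewrite /flat_span (_ : [set _ in _] = [set nth w S (n - 1)]); last first.
    by apply/setP => a; rewrite !inE.
  by rewrite big_set1 => /rep_in_line ->; rewrite ltnn.
have minS l x : 0 < l < m -> x \in tail_flat S l ->
    pos sigma (tail_point S l) <= pos sigma x.
  move=> lm xl; rewrite leqNgt; apply/negP => lt.
  have : fail l by apply/andP; split; [clear_lia|apply/exists_inP; exists x].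
  by move/mmin; clear_lia.
pose U := drop (n - m) S.
have sU : size U = m by rewrite size_drop Sn; clear_lia.
have sU' : size U == n - (n - m) by apply/eqP; clear_lia.
have flatU l : l <= m -> tail_flat U l = tail_flat S l.
  move=> lm; rewrite /tail_flat sU /U drop_drop Sn.
  by rewrite (_ : m - l + (n - m) = n - l); last clear_lia.
have pointU l : l <= m -> tail_point U l = tail_point S l.
  move=> lm; rewrite /tail_point sU /U nth_drop Sn.
  by congr nth; clear_lia.
have US x : x \in U -> x \in S by apply: mem_drop.
have iU : independent_avoiding w U.
  move: iS => /and3P[_ fS wS]; apply/and3P; split; first exact: drop_uniq.
    apply: (@catr_free _ _ (map r (take (n - m) S))).
    by rewrite reps_pts -map_cat cat_take_drop -reps_pts.
  apply: contra wS; rewrite !reps_pts !span_map_flat.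
  by apply/subvP/flatS/subsetP => a; rewrite !inE; apply: US.
pose u := tail_point U m.
have uE : u = nth w S (n - m) by rewrite /u pointU // /tail_point Sn.
have pos_gt0 x : x != w -> 0 < pos sigma x.
  by move=> xw; rewrite lt0n -sw (inj_eq (@pos_inj _ _)).
have zw : z != w by apply: contraTneq zm => ->; apply: w_notin_tail_flat.
have zu : pos sigma z < pos sigma u by rewrite /u pointU.
pose B := [set x in take (n - m) S].
have memB x : x \in B -> x \in S by rewrite inE; apply: mem_take.
have B_lt x : x \in B -> pos sigma x < pos sigma u.
  rewrite inE => /(nthP w)[j]; rewrite size_take_min Sn => jm.
  rewrite nth_take; last clear_lia.
  by move=> <-; rewrite uE; apply: sS; clear_lia.
have wnS : w \notin S by rewrite memS; apply: contra wA; apply: mem_flat.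
have BP : B \subset [set x | 0 < pos sigma x < pos sigma u].
  apply/subsetP => x xB; rewrite inE B_lt // pos_gt0 //.
  by apply: contraNneq wnS => <-; apply: memB.
have Bk : #|B| = n - m.
  by rewrite cardsE (card_uniqP (take_uniq _ uS)) size_take_min Sn; clear_lia.
(* z lies in the span of U, so z in B would contradict the independence of A. *)
have zB : z \notin B.
  have dA' : \dim (flat A) = #|A| by rewrite dA An.
  apply/negP => zB; have := memB _ zB; rewrite memS => /(flatD1_notin dA')/negP; apply.
  move: zm; rewrite inE; apply/subvP/flatS/subsetP => a; rewrite !inE Sn => aU.
  rewrite -memS US // andbT; apply: contraTneq zB => <-; rewrite inE.
  apply/negP => aT; move: uS; rewrite -(cat_take_drop (n - m) S) cat_uniq.
  by move=> /and3P[_ /hasPn/(_ _ aU)/negP].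
(* The n - m points of B and z are distinct and strictly between w and u, so d - 2 is at least k +
   1. *)
have d_ge : n - m + 3 <= (pos sigma u).+1.
  have : #|z |: B| <= #|[set x | 0 < pos sigma x < pos sigma u]|.
    apply: subset_leq_card; apply/subsetP => x; rewrite in_setU1 => /predU1P[->|].
      by rewrite inE zu pos_gt0.
    exact: (subsetP BP).
  rewrite cardsU1 zB Bk (card_pos_between cardT); last by rewrite ltnW // (pos_lt cardT).
  clear_lia.
(* By minimality of m the first point of this flat is u_(m-1), which comes after u in the increasing
   list. *)
have later x : x \in tail_flat U m.-1 -> pos sigma u < pos sigma x.
  rewrite flatU; last clear_lia.
  move=> xl; apply: leq_trans (minS m.-1 x _ xl); last by clear_lia.
  by rewrite uE /tail_point Sn; apply: sS; clear_lia.
(* The q_(m-1) points of that flat fit into the T - d places after u. *)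
have d_le : (pos sigma u).+1 <= T - q_count U m.-1.
  have : #|tail_flat U m.-1| <= #|[set x | pos sigma u < pos sigma x]|.
    by apply: subset_leq_card; apply/subsetP => x /later; rewrite inE.
  have : pos sigma u < T := pos_lt cardT sigma u.
  by rewrite (card_pos_gt cardT) -q_countE; clear_lia.
(* The point z, which lies in the span of U and precedes u, keeps [sigma] out of the subtracted
   set. *)
have sC : sigma \in chain_orderings U (pos sigma u).+1.
  rewrite !inE sU sw !eqxx /=; apply/and3P; split.
  - apply/negP => /andP[/forall_inP/(_ z) zQ _].
    have /zQ : z \in tail_flat U m :\ tail_point U m.
      by rewrite in_setD1 flatU // zm andbT; apply: contraTneq zu => ->; rewrite ltnn.
    by rewrite ltnNge ltnW.
  - by apply/forall_inP => x /later.
  - apply/minimaP => l lm x xl; rewrite pointU; last clear_lia.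
    by apply: minS; [clear_lia|rewrite -flatU //; clear_lia].
have AE : A = B :|: [set x in U].
  by apply/setP => x; rewrite !inE -mem_cat cat_take_drop memS.
apply: (@mem_bigcup_seq _ _ _ _ _ (n - m)) => //.
  by rewrite mem_index_iota; clear_lia.
apply/bigcupP; exists (Tuple sU') => //=.
apply: (@mem_bigcup_seq _ _ _ _ _ (pos sigma u).+1) => //.
  rewrite mem_index_iota d_ge ltnS /= (_ : n - (n - m) - 1 = m.-1) //; clear_lia.
rewrite /broken_cover /= sC AE; apply: imset_f.
by rewrite inE BP Bk eqxx.
Qed.

End Averaging.

(** * The average *)

Section Count.
Set Implicit Arguments.
Unset Strict Implicit.

Lemma ffactnD (N a b : nat) : (N ^_ (a + b) = N ^_ a * (N - a) ^_ b)%N.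
Proof.
elim: b => [|b IHb]; first by rewrite addn0 muln1.
by rewrite addnS !ffactnSr IHb subnDA mulnA.
Qed.

(** With p = q_(m-1) and q = q_m, the right side is the difference of the counts for sets Q of sizes
    p and q - 1. Each binomial times (q - p - 1)! is a falling factorial, which links the two
    sides. *)
Lemma order_count_formula (T d q p : nat) :
    (1 < d <= T - p)%N -> (p < q < T)%N ->
  ((T - d)`!%:R * (T - q - 1)`!%:R) / (T - p - d)`!%:R *
    (('C(T - p - 2, q - p - 1)%:R - 'C(T - p - d, q - p - 1)%:R) * (q - p - 1)`!%:R) =
  ((T - d) ^_ p * (T - 2 - p)`!)%:R
    - ((T - d) ^_ (q - 1) * (T - 2 - (q - 1))`!)%:R :> rat.
Proof.
move=> dT pq.
have -> : (T - d)`! = ((T - d) ^_ p * (T - p - d)`!)%N.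
  by rewrite -(@ffact_fact (T - d) p); [congr (_ * _`!)%N|]; lia.
have -> : (T - 2 - p = T - p - 2)%N by lia.
rewrite -(@bin_fact (T - p - 2) (q - p - 1)); last by lia.
have -> : (T - p - 2 - (q - p - 1) = T - q - 1)%N by lia.
have -> : (T - d) ^_ (q - 1) =
    ((T - d) ^_ p * ('C(T - p - d, q - p - 1) * (q - p - 1)`!))%N.
  rewrite bin_ffact (_ : (q - 1 = p + (q - p - 1))%N); last by lia.
  by rewrite ffactnD; congr (_ * _ ^_ _)%N; lia.
have -> : (T - 2 - (q - 1) = T - q - 1)%N by lia.
have f0 : (T - p - d)`!%:R != 0 :> rat by rewrite pnatr_eq0 -lt0n fact_gt0.
rewrite !natrM [X in X / _]mulrAC mulfK // mulrBl mulrBr !mulrA.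
congr (_ - _); first by rewrite -!mulrA; congr (_ * _); rewrite mulrC -!mulrA.
by rewrite -!mulrA; congr (_ * _); rewrite mulrC -!mulrA.
Qed.

Variables (R : realType) (n : nat) (T : nat) (H : {fset RP R n}).
Hypothesis cardH : #|` H| = T.
Variable w : H.
Implicit Types (U : seq H).

Lemma card_chain_orderings U d : independent_avoiding w U -> (1 < size U)%N ->
    (1 < d <= T - q_count U (size U - 1))%N ->
  #|chain_orderings w U d|%:R =
  (\prod_(1 <= l < size U) (q_count U l)%:R)^-1 *
    (((T - d)`!%:R * (T - q_count U (size U) - 1)`!%:R)
       / (T - q_count U (size U - 1) - d)`!%:R * A_coef T (size U) U d) :> rat.
Proof.
move=> iU U1 dT; set m := size U.
have U0 : (0 < m)%N by rewrite ltnW.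
set u := tail_point w U m.
have Fp : tail_flat U m.-1 \subset tail_flat U m by apply: tail_flatS; apply: leq_pred.
have uF : u \in tail_flat U m by apply: mem_tail_flat; rewrite U0 leqnn.
have uF' : u \notin tail_flat U m.-1.
  by apply: tail_point_notin => //; rewrite leqnn andbT -/m; lia.
have FQ : tail_flat U m.-1 \subset tail_flat U m :\ u by rewrite subsetD1 Fp.
have wF l : w \notin tail_flat U l by apply: w_notin_tail_flat.
have wQ : w \notin tail_flat U m :\ u by rewrite in_setD1 negb_and wF orbT.
have card_at := card_chain_orderings_at cardH iU U0.
have qQ : #|tail_flat U m :\ u| = (q_count U m - 1)%N.
  by rewrite q_countE (cardsD1 u (tail_flat U m)) uF add1n subn1.
(* u_m is a new point of the larger flat, and w lies outside it. *)
have pq : (q_count U m.-1 < q_count U m < T)%N.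
  apply/andP; split.
    have q0 : (0 < q_count U m)%N by rewrite q_countE; apply/card_gt0P; exists u.
    by move: (subset_leq_card FQ); rewrite qQ -q_countE; lia.
  rewrite -cardH cardfE q_countE -[X in (X <= _)%N]add1n.
  by have := max_card (mem (w |: tail_flat U m)); rewrite cardsU1 wF.
have sub : chain_orderings_at w U d (tail_flat U m :\ u)
    \subset chain_orderings_at w U d (tail_flat U m.-1).
  apply/subsetP => sigma; rewrite !inE => /andP[/and3P[-> -> /forall_inP sQ] ->].
  by rewrite andbT /=; apply/forall_inP => x /(subsetP FQ)/sQ.
have prod0 : \prod_(1 <= l < m) (q_count U l)%:R != 0 :> rat.
  rewrite prodf_seq_neq0; apply/allP => l; rewrite mem_index_iota => lm.
  rewrite pnatr_eq0 -lt0n q_countE; apply/card_gt0P; exists (tail_point w U l).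
  by apply: mem_tail_flat; rewrite -/m; lia.
apply: (mulfI prod0); rewrite mulVKf // /A_coef -subn1.
rewrite order_count_formula // -/m -?subn1 //; last by rewrite subn1.
rewrite /chain_orderings cardsDS // natrB ?subset_leq_card // mulrBr -natr_prod -!natrM.
have dT' : (1 < d <= T)%N by lia.
congr (_%:R - _%:R); rewrite mulnC card_at // ?qQ //.
  by rewrite -q_countE subn1.
by rewrite in_setD1 eqxx.
Qed.

(** For w outside A, [w |: A] has n + 1 elements, so it is dependent exactly when its span is
    proper. *)
Lemma card_degenerate_cones : #|degenerate_cones w| = D_count w.
Proof.
apply: eq_card => A; rewrite !inE; case: eqP => //= An; case wA: (w \in A) => //=.
have -> : rep (val w) :: reps (pts (enum A)) = [seq rep (val x) | x <- w :: enum A].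
  by rewrite /= reps_pts.
rewrite free_map_flat /= ?mem_enum ?wA ?enum_uniq //.
have -> : [set x in w :: enum A] = w |: A.
  by apply/setP => x; rewrite !inE mem_enum.
have := KH_dim (w |: A); rewrite inE => ->.
have := dim_flat (fun x : H => rep (val x)) (w |: A); rewrite cardsU1 wA An add1n.
by rewrite leq_eqVlt ltnS; case: eqP => [->|_ /= ->] //=; rewrite ltnn.
Qed.

(** This is the union bound on the cover for one fixed order, ready to be summed over the orders. *)
Lemma rank_le_orderings (F : fieldType) (sigma : {perm H}) :
  sigma \in first_orderings w ->
  (rank_rel_homology F n (KH H) (skeleton_lt n (KH H)) <= D_count w +
     \sum_(0 <= k < n - 1)
      \sum_(U : (n - k).-tuple H | independent_avoiding w U)
       \sum_(k + 3 <= d < (T - q_count U (n - k - 1)).+1)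
         (sigma \in chain_orderings w U d) * 'C(d - 2, k))%N.
Proof.
rewrite inE => /eqP sw; apply: leq_trans (rank_le_card _ (@pos_inj _ sigma) w) _.
rewrite card_degenerate_cones leq_add2l.
apply: leq_trans (subset_leq_card (broken_bases_cover cardH sw)) _.
apply: leq_trans (card_bigcup_le _ _ _) _; apply: leq_sum => k _.
apply: leq_trans (card_bigcup_le _ _ _) _; apply: leq_sum => U _.
apply: leq_trans (card_bigcup_le _ _ _) _; rewrite !big_nat; apply: leq_sum => d dT.
by apply: (card_broken_cover w cardH); lia.
Qed.

End Count.

Theorem theorem4 (R : realType) (n T : nat) (H : {fset RP R n}) (F : fieldType)
    (w : H) (cardH : #|` H| = T)
    (spanH : <<reps (enum_fset H)>>%VS = fullv) :
  (rank_rel_homology F n (KH H) (skeleton_lt n (KH H)))%:R <=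
    ((T - 1)`!%:R)^-1 *
      (\sum_(0 <= k < n - 1)
         \sum_(U : (n - k).-tuple H | independent_avoiding w U)
           (\prod_(1 <= l < n - k) (q_count U l)%:R)^-1 *
           \sum_(k + 3 <= d < (T - q_count U (n - k - 1)).+1)
             ((T - d)`!%:R * (T - q_count U (n - k) - 1)`!%:R)
               / (T - q_count U (n - k - 1) - d)`!%:R
             * A_coef T (n - k) U d * 'C(d - 2, k)%:R)
    + (D_count w)%:R :> rat.
Proof.
have cardO : #|first_orderings w| = (T - 1)`!.
  by rewrite subn1; apply: card_first_orderings; rewrite -cardfE.
have fact0 : 0 < (T - 1)`!%:R :> rat by rewrite ltr0n fact_gt0.
(* Clearing (T - 1)! turns both sides into natural numbers: the average becomes a sum over the
   orders with w first. *)
rewrite -(ler_pM2l fact0) mulrDr (mulVKf (lt0r_neq0 fact0)).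
pose total : nat := \sum_(0 <= k < n - 1)
  \sum_(U : (n - k).-tuple H | independent_avoiding w U)
  \sum_(k + 3 <= d < (T - q_count U (n - k - 1)).+1)
    #|chain_orderings w U d| * 'C(d - 2, k).
have -> : \sum_(0 <= k < n - 1)
         \sum_(U : (n - k).-tuple H | independent_avoiding w U)
           (\prod_(1 <= l < n - k) (q_count U l)%:R)^-1 *
           \sum_(k + 3 <= d < (T - q_count U (n - k - 1)).+1)
             ((T - d)`!%:R * (T - q_count U (n - k) - 1)`!%:R)
               / (T - q_count U (n - k - 1) - d)`!%:R
             * A_coef T (n - k) U d * 'C(d - 2, k)%:R = total%:R :> rat.
  rewrite /total natr_sum; apply: eq_big_nat => k kn.
  rewrite natr_sum; apply: eq_bigr => U iU.
  rewrite natr_sum mulr_sumr; apply: eq_big_nat => d dT.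
  have U1 : (1 < size U)%N by rewrite size_tuple; lia.
  have dU : (1 < d <= T - q_count U (size U - 1))%N 
    by case/andP: dT => kd dq; rewrite size_tuple (leq_trans _ kd) ?addn3 //; exact: dq.
  by rewrite natrM (card_chain_orderings cardH iU U1 dU) size_tuple !mulrA.
rewrite -!natrM -natrD ler_nat -cardO.
apply: (@leq_trans (\sum_(sigma in first_orderings w) (D_count w +
     \sum_(0 <= k < n - 1)
      \sum_(U : (n - k).-tuple H | independent_avoiding w U)
       \sum_(k + 3 <= d < (T - q_count U (n - k - 1)).+1)
         (sigma \in chain_orderings w U d) * 'C(d - 2, k)))).
  by rewrite -sum_nat_const; apply: leq_sum => sigma; apply: rank_le_orderings.
rewrite big_split sum_nat_const [X in (X <= _)%N]addnC leq_add2r.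
(* Moving the sum over orders innermost counts, for each U and d, the orders in [chain_orderings]
   that put w first. *)
rewrite exchange_big; apply: leq_sum => k _.
rewrite exchange_big; apply: leq_sum => U _.
rewrite exchange_big; apply: leq_sum => d _.
rewrite -big_distrl leq_mul2r; apply/orP; right.
rewrite -sum1_card big_mkcond [X in (_ <= X)%N]big_mkcond.
by apply: leq_sum => sigma _; case: (sigma \in first_orderings w); case: (_ \in _).
Qed.
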